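(* Let $n\ge 1$ and let $P\in\operatorname{Sym}_{2n}$. Then there exists a unique $Q\in\operatorname{Sym}_n$ such that \[ P\left(x_1,\ldots,x_n,x_1^{-1},\ldots,x_n^{-1}\right)=Q\left(x_1+x_1^{-1},\ldots,x_n+x_n^{-1}\right). \]
   Context: $\operatorname{Sym}_N$ denotes the algebra of symmetric polynomials in $N$ variables with complex coefficients. The displayed identity is an identity of Laurent polynomials in the independent variables $x_1,\ldots,x_n$. *)

(* Defs.v *)
From HB Require Import structures.
From mathcomp Require Import all_boot all_order all_algebra.
From mathcomp Require Import boolp reals.
From mathcomp Require Import complex mpoly.

Set Implicit Arguments.
Unset Strict Implicit.
Unset Printing Implicit Defensive.

Import GRing.Theory.

Local Open Scope ring_scope.

(* The ring of Laurent polynomials K[x_1^{+-1}, ..., x_n^{+-1}], realized as the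
   subring of the rational functions in x_1, ..., x_n consisting of the
   fractions p / x^m with p a polynomial and x^m a monomial.                  *)
Section Laurent.
Variables (K : fieldType) (n : nat).

Local Notation F := {fraction {mpoly K[n]}}.

Definition is_laurent : {pred F} := fun f =>
  `[< exists (p : {mpoly K[n]}) (m : 'X_{1..n}),
        f = tofrac p / tofrac 'X_[m] >].

Lemma is_laurentP f :
  reflect (exists (p : {mpoly K[n]}) (m : 'X_{1..n}),
             f = tofrac p / tofrac 'X_[m]) (f \in is_laurent).
Proof. exact: asboolP. Qed.

Lemma tofracX_neq0 (m : 'X_{1..n}) : tofrac 'X_[K, m] != 0.
Proof. by rewrite tofrac_eq0 -msupp_eq0 msuppX. Qed.

Fact is_laurent_subring : subring_closed is_laurent.
Proof.
split.
- apply/is_laurentP; exists 1, 0%MM.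
  by rewrite mpolyX0 tofrac1 divr1.
- move=> f g /is_laurentP[p [m ->]] /is_laurentP[q [k ->]].
  apply/is_laurentP; exists (p * 'X_[k] - q * 'X_[m]), (m + k)%MM.
  rewrite -mulNr addf_div ?tofracX_neq0 // mpolyXD.
  by rewrite mulNr -!tofracM -tofracB.
- move=> f g /is_laurentP[p [m ->]] /is_laurentP[q [k ->]].
  apply/is_laurentP; exists (p * q), (m + k)%MM.
  by rewrite mulf_div mpolyXD -!tofracM.
Qed.

HB.instance Definition _ :=
  GRing.isSubringClosed.Build F is_laurent is_laurent_subring.

Record laurent := Laurent { laurent_val :> F; _ : laurent_val \in is_laurent }.

HB.instance Definition _ := [isSub for laurent_val].
HB.instance Definition _ := [Choice of laurent by <:].
HB.instance Definition _ := [SubChoice_isSubComNzRing of laurent by <:].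

Fact laurent_poly_subproof (p : {mpoly K[n]}) : tofrac p \in is_laurent.
Proof. by apply/is_laurentP; exists p, 0%MM; rewrite mpolyX0 tofrac1 divr1. Qed.

Definition laurent_poly (p : {mpoly K[n]}) : laurent :=
  Laurent (laurent_poly_subproof p).

Definition laurentC (c : K) : laurent := laurent_poly c%:MP.

Definition laurentX (i : 'I_n) : laurent := laurent_poly 'X_i.

Fact laurentXV_subproof (i : 'I_n) : (tofrac 'X_i)^-1 \in is_laurent.
Proof. by apply/is_laurentP; exists 1, U_(i)%MM; rewrite tofrac1 div1r. Qed.

Definition laurentXV (i : 'I_n) : laurent := Laurent (laurentXV_subproof i).

Lemma laurentXK (i : 'I_n) : laurentX i * laurentXV i = 1.
Proof. by apply: val_inj; rewrite /= divff ?tofracX_neq0. Qed.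

Fact laurentC_is_zmod_morphism : zmod_morphism laurentC.
Proof. by move=> a b; apply: val_inj; rewrite /= mpolyCB tofracB. Qed.

Fact laurentC_is_monoid_morphism : monoid_morphism laurentC.
Proof.
split; first by apply: val_inj; rewrite /= tofrac1.
by move=> a b; apply: val_inj; rewrite /= mpolyCM tofracM.
Qed.

HB.instance Definition _ :=
  GRing.isZmodMorphism.Build K laurent laurentC laurentC_is_zmod_morphism.
HB.instance Definition _ :=
  GRing.isMonoidMorphism.Build K laurent laurentC laurentC_is_monoid_morphism.

End Laurent.

Definition laurent_subst (K : fieldType) (n N : nat)
    (v : 'I_N -> laurent K n) (P : {mpoly K[N]}) : laurent K n :=
  mmap (@laurentC K n) v P.

(* The tuple (x_1, ..., x_n, x_1^-1, ..., x_n^-1): split sends the first n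
   indices of 'I_(n + n) to inl and the last n to inr.                        *)
Definition vars_and_inverses (K : fieldType) (n : nat)
    (i : 'I_(n + n)) : laurent K n :=
  match split i with
  | inl j => laurentX K j
  | inr j => laurentXV K j
  end.

Definition vars_plus_inverses (K : fieldType) (n : nat)
    (i : 'I_n) : laurent K n :=
  laurentX K i + laurentXV K i.

(* Main.v *)
From HB Require Import structures.
Require Import Defs.
From mathcomp Require Import all_boot all_order all_fingroup all_algebra.
From mathcomp Require Import reals.
From mathcomp Require Import complex mpoly.

(** Existence rests on generating functions.  By the fundamental theorem of
    symmetric polynomials, P is a polynomial in the elementary symmetric
    polynomials e_1, ..., e_2n, so it suffices to treat those.  At the point
    (x, x^-1) their generating series is
      prod_i (1 + x_i t) (1 + x_i^-1 t) = prod_i (1 + (x_i + x_i^-1) t + t^2),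
    whose coefficients are visibly symmetric polynomials in the quantities
    y_i = x_i + x_i^-1 ([mmap_mesym_with_inverses], [sym_with_inverses]).
    Only the relations x_i x_i^-1 = 1 enter, so this half is carried out in an
    arbitrary commutative ring.

    Uniqueness is the algebraic independence of y_1, ..., y_n
    ([laurent_subst_vars_plus_inverses_eq0]).  Since x_i y_i = x_i^2 + 1, a
    common power (x_1 ... x_n)^D with D large turns the monomial y^m into the
    polynomial prod_i (x_i^2 + 1)^(m_i) x_i^(D - m_i), with leading monomial
    x^(D + m).  Distinct m have distinct leading monomials, compared as the m
    themselves are, so the leading monomial of a nonzero Q survives in
    (x_1 ... x_n)^D Q(y). *)

Import Order.TTheory GRing.Theory.
Local Open Scope ring_scope.

Set Implicit Arguments.
Unset Strict Implicit.
Unset Printing Implicit Defensive.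

Lemma mmap_comp_mpoly (K : nzRingType) (L : comNzRingType)
    (f : {rmorphism K -> L}) (n k : nat) (h : 'I_n -> L)
    (T : k.-tuple {mpoly K[n]}) (p : {mpoly K[k]}) :
  mmap f h (p \mPo T) = mmap f (fun i => mmap f h (tnth T i)) p.
Proof.
rewrite comp_mpolyEX rmorph_sum /=; apply: eq_bigr => m _.
rewrite mmapZ comp_mpolyX rmorph_prod /=; congr (_ * _).
by apply: eq_bigr => i _; rewrite rmorphXn.
Qed.

(** Expanding the product over the set of factors contributing a 'X. *)
Lemma mmap_mesym (K : nzRingType) (L : comNzRingType)
    (f : {rmorphism K -> L}) (N : nat) (z : 'I_N -> L) (k : nat) :
  mmap f z (mesym N K k) = (\prod_(i < N) (1 + z i *: 'X))`_k.
Proof.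
under eq_bigr do rewrite addrC.
rewrite bigA_distr /= coef_sum /mesym rmorph_sum /= [LHS]big_mkcond /=.
apply: eq_bigr => A _; rewrite -big_mkcond /= scaler_prod prodr_const.
rewrite coefZ coefXn eq_sym; case: eqP => _; last by rewrite mulr0.
rewrite mulr1 rmorph_prod /=.
by apply: eq_bigr => i _; rewrite mmapX mmap1U.
Qed.

(** The generating polynomial of the symmetric polynomials in y_i = u_i + u_i^-1
    that express the elementary symmetric polynomials of the u_i and u_i^-1. *)
Definition palindromic_gen (K : comNzRingType) (n : nat) : {poly {mpoly K[n]}} :=
  \prod_(i < n) (1 + 'X_i *: 'X + 'X^2).

Lemma palindromic_gen_sym (K : comNzRingType) (n k : nat) :
  (palindromic_gen K n)`_k \is symmetric.
Proof.
apply/issymP => s; rewrite /palindromic_gen -coef_map /=.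
congr (nth _ (polyseq _) k).
rewrite rmorph_prod [RHS](reindex_inj (@perm_inj _ s)) /=.
apply: eq_bigr => i _; rewrite !rmorphD /= rmorph1 map_polyZ map_polyXn map_polyX.
by rewrite /= /msym mmapX mmap1U.
Qed.

Lemma mmap_palindromic_gen (K L : comNzRingType) (f : {rmorphism K -> L})
    (n : nat) (y : 'I_n -> L) (k : nat) :
  mmap f y (palindromic_gen K n)`_k = (\prod_(i < n) (1 + y i *: 'X + 'X^2))`_k.
Proof.
rewrite /palindromic_gen -coef_map /= rmorph_prod; congr (nth _ (polyseq _) k).
apply: eq_bigr => i _.
rewrite !rmorphD /= rmorph1 map_polyZ map_polyXn map_polyX.
by rewrite /= mmapX mmap1U.
Qed.

(** The tuple (x, x^-1) with the Laurent polynomial ring replaced by any L. *)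
Definition with_inverses (L : Type) (n : nat) (u v : 'I_n -> L)
    (i : 'I_(n + n)) : L :=
  match split i with inl j => u j | inr j => v j end.

(** The factors of u_i and v_i pair up: (1 + u_i t) (1 + v_i t) is
    1 + (u_i + v_i) t + t^2 because u_i v_i = 1. *)
Lemma mmap_mesym_with_inverses (K L : comNzRingType) (f : {rmorphism K -> L})
    (n : nat) (u v : 'I_n -> L) (k : nat) :
  (forall i, u i * v i = 1) ->
  mmap f (with_inverses u v) (mesym (n + n) K k) =
  mmap f (fun i => u i + v i) (palindromic_gen K n)`_k.
Proof.
move=> uvK; rewrite mmap_mesym mmap_palindromic_gen; congr (nth _ (polyseq _) k).
rewrite big_split_ord /= -big_split /=; apply: eq_bigr => i _.
rewrite /with_inverses (unsplitK (inl i)) (unsplitK (inr i)).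
rewrite mulrDl mul1r mulrDr mulr1 -scalerAl -scalerAr scalerA uvK scale1r.
by rewrite scalerDl -expr2 [_ *: 'X + _ *: 'X]addrC !addrA.
Qed.

Lemma sym_with_inverses (K L : comNzRingType) (f : {rmorphism K -> L})
    (n : nat) (u v : 'I_n -> L) (P : {mpoly K[n + n]}) :
    (forall i, u i * v i = 1) -> P \is symmetric ->
  exists2 Q : {mpoly K[n]}, Q \is symmetric &
    mmap f (with_inverses u v) P = mmap f (fun i => u i + v i) Q.
Proof.
move=> uvK /sym_fundamental[t [<- _]].
exists (t \mPo [tuple (palindromic_gen K n)`_(i.+1) | i < n + n]).
  apply: mcomp_sym => i; rewrite -tnth_nth tnth_mktuple.
  exact: palindromic_gen_sym.
rewrite !mmap_comp_mpoly; apply: eq_bigr => m _; congr (_ * _).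
by apply: mmap1_eq => i; rewrite !tnth_mktuple mmap_mesym_with_inverses.
Qed.

Section Independence.
Variables (K : fieldType) (n : nat).

Fact laurent_poly_is_zmod_morphism : zmod_morphism (@laurent_poly K n).
Proof. by move=> p q; apply: val_inj; rewrite /= tofracB. Qed.

Fact laurent_poly_is_monoid_morphism : monoid_morphism (@laurent_poly K n).
Proof.
split; first by apply: val_inj; rewrite /= tofrac1.
by move=> p q; apply: val_inj; rewrite /= tofracM.
Qed.

HB.instance Definition _ := GRing.isZmodMorphism.Build {mpoly K[n]} (laurent K n)
  (@laurent_poly K n) laurent_poly_is_zmod_morphism.
HB.instance Definition _ := GRing.isMonoidMorphism.Build {mpoly K[n]} (laurent K n)
  (@laurent_poly K n) laurent_poly_is_monoid_morphism.

Lemma laurent_poly_inj : injective (@laurent_poly K n).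
Proof. by move=> p q /(congr1 val)/= /eqP; rewrite tofrac_eq => /eqP. Qed.

(** The monomial in the x_i + x_i^-1 with exponents m, after multiplication by
    (x_1 ... x_n)^D; see [laurent_poly_cleared].  The exponents D - m_i are not
    truncated as long as D bounds all m_i. *)
Definition cleared (D : nat) (m : 'X_{1..n}) : {mpoly K[n]} :=
  \prod_(i < n) (('X_i ^+ 2 + 1) ^+ m i * 'X_i ^+ (D - m i)).

Lemma mlead_Xsq1 (i : 'I_n) : mlead ('X_i ^+ 2 + 1 : {mpoly K[n]}) = (U_(i) *+ 2)%MM.
Proof.
rewrite mpolyXn mleadDl ?mleadXm // mlead1.
by apply: lt_mdeg_ltmc; rewrite mdeg0 mdegMn mdeg1.
Qed.

Lemma Xsq1_neq0 (i : 'I_n) : 'X_i ^+ 2 + 1 != 0 :> {mpoly K[n]}.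
Proof.
apply/eqP => X0; have /(congr1 mdeg) := mlead_Xsq1 i.
by rewrite X0 mlead0 mdeg0 mdegMn mdeg1.
Qed.

Lemma cleared_neq0 D m : cleared D m != 0.
Proof.
apply/prodf_neq0 => i _; rewrite mulf_neq0 ?expf_neq0 ?Xsq1_neq0 //.
by rewrite -msupp_eq0 msuppX.
Qed.

Lemma mlead_cleared D (m : 'X_{1..n}) : (forall i, m i <= D)%N ->
  mlead (cleared D m) = ([multinom D | i < n] + m)%MM.
Proof.
move=> le_mD; rewrite mlead_prod; last first.
  by move=> i _ _; move: (cleared_neq0 D m) => /prodf_neq0; apply.
transitivity (\sum_(i < n) U_(i) *+ (D + m i))%MM; last first.
  rewrite [RHS]multinomUE_id; apply: eq_bigr => i _.
  by rewrite mnmDE mnmE.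
apply: eq_bigr => i _.
rewrite mleadM ?mleadX ?mlead_Xsq1 ?mleadXm ?expf_neq0 ?Xsq1_neq0 //;
  try by rewrite -msupp_eq0 msuppX.
apply/mnmP => j; rewrite mnmDE !mulmnE -mulnA -mulnDr; congr (_ * _)%N.
by rewrite mul2n -addnn -addnA subnKC // addnC.
Qed.

(** Factor by factor, from x_i^2 + 1 = x_i (x_i + x_i^-1). *)
Lemma laurent_poly_cleared D (m : 'X_{1..n}) : (forall i, m i <= D)%N ->
  laurent_poly (cleared D m) =
  (\prod_(i < n) laurentX K i ^+ D) * mmap1 (@vars_plus_inverses K n) m.
Proof.
move=> le_mD; rewrite rmorph_prod -big_split /=; apply: eq_bigr => i _.
rewrite rmorphM !rmorphXn rmorphD rmorphXn rmorph1 -/(laurentX K i).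
have -> : laurentX K i ^+ 2 + 1 = laurentX K i * vars_plus_inverses K i.
  by rewrite mulrDr laurentXK expr2.
by rewrite exprMn mulrAC -exprD subnKC.
Qed.

(** The coefficient of the cleared polynomial at the leading monomial of the
    term coming from [mlead Q] receives a contribution from that term only, as
    every other exponent m of Q has m < mlead Q. *)
Lemma laurent_subst_vars_plus_inverses_eq0 (Q : {mpoly K[n]}) :
  laurent_subst (@vars_plus_inverses K n) Q = 0 -> Q = 0.
Proof.
move=> Q0; apply/eqP; apply: contraT => nzQ.
(* The total degree bounds every exponent, so D clears all denominators. *)
pose D := msize Q; pose N := \sum_(m <- msupp Q) Q@_m *: cleared D m.
have le_D m : m \in msupp Q -> forall i, (m i <= D)%N.
  move=> /msize_mdeg_lt/ltnW mD i; apply: leq_trans mD.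
  by rewrite mdegE (bigD1 i) //= leq_addr.
have N0 : N = 0.
  apply: laurent_poly_inj; rewrite rmorph0 rmorph_sum /=.
  transitivity ((\prod_(i < n) laurentX K i ^+ D) *
                laurent_subst (@vars_plus_inverses K n) Q); last first.
    by rewrite Q0 mulr0.
  rewrite [X in _ * X]/mmap mulr_sumr big_seq [RHS]big_seq.
  apply: eq_bigr => m /le_D mD.
  by rewrite -mul_mpolyC rmorphM /= laurent_poly_cleared // mulrCA.
have /eqP := congr1 (mcoeff (mlead (cleared D (mlead Q)))) N0.
rewrite mcoeff0 raddf_sum /= (bigD1_seq (mlead Q)) ?msupp_uniq ?mlead_supp //=.
rewrite big_seq_cond big1 ?addr0 => [|m /andP[mQ ne_m]].
  by rewrite mcoeffZ mulf_eq0 !mleadc_eq0 (negPf nzQ) (negPf (cleared_neq0 _ _)).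
rewrite mcoeffZ [X in _ * X]mcoeff_gt_mlead ?mulr0 //.
rewrite (mlead_cleared (le_D _ mQ)) (mlead_cleared (le_D _ (mlead_supp nzQ))).
by rewrite ltmc_add2r lt_neqAle ne_m msupp_le_mlead.
Qed.
End Independence.

Theorem theorem1p1 (R : realType) (n : nat) (hn : (1 <= n)%N)
    (P : {mpoly R[i][n + n]}) (hP : P \is symmetric) :
  exists! Q : {mpoly R[i][n]},
    Q \is symmetric /\
    laurent_subst (@vars_and_inverses R[i] n) P =
    laurent_subst (@vars_plus_inverses R[i] n) Q.
Proof.
have [Q symQ PQ] := sym_with_inverses (@laurentC R[i] n)
  (@laurentXK R[i] n) hP.
exists Q; split=> // Q' [_ PQ']; apply/eqP; rewrite -subr_eq0; apply/eqP.
apply: laurent_subst_vars_plus_inverses_eq0; apply/eqP.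
by rewrite /laurent_subst rmorphB subr_eq0; apply/eqP; rewrite -[RHS]PQ' -[LHS]PQ.
Qed.
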